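(* Let $G$ be an almost locally free group and let $M$ be a maximal Abelian subgroup of $G$. Then there is a set $S(M)$ of primes (possibly empty) such that $M$ is elementarily equivalent to (the additive group of) $\mathbb{Z}[S(M)^{-1}]$.
   Context: Let $L_o$ be the first-order language of group theory: its only relation symbol is $=$ (always interpreted as identity), and its only function and constant symbols are a binary operation symbol $\cdot$, a unary symbol $^{-1}$ and a constant symbol $1$. A $\Pi_2$-sentence (universal-existential sentence) of $L_o$ is a sentence logically equivalent to one of the form $\forall x_1\cdots\forall x_m\exists y_1\cdots\exists y_n\,\psi(x_1,\dots,x_m,y_1,\dots,y_n)$ with $\psi$ quantifier-free and containing free at most the distinct variables displayed; vacuous quantifications are permitted. Let $F_2$ be a free group of rank $2$, and let $\mathrm{Th}(F_2)\cap\forall\exists$ be the set of all $\Pi_2$-sentences of $L_o$ true in $F_2$. (By a theorem of Sacerdote this is also the set of all $\Pi_2$-sentences true in every non-Abelian free group.) A group $G$ is almost locally free if it is a model of $\mathrm{Th}(F_2)\cap\forall\exists$, i.e. every sentence in this set is true in $G$. Two groups are elementarily equivalent if they satisfy exactly the same sentences of $L_o$. For a set $S$ of primes, $\mathbb{Z}[S^{-1}]$ denotes the additive group of the subring of $\mathbb{Q}$ generated by $\mathbb{Z}$ and $\{1/p : p\in S\}$. *)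

(* Defs.v *)
From HB Require Import structures.
From mathcomp Require Import all_boot all_order all_algebra.
From mathcomp Require Import boolp.

Set Implicit Arguments.
Unset Strict Implicit.
Unset Printing Implicit Defensive.

(* The variables x_0, x_1, ... are named by their indices. *)
Inductive term :=
  | tVar of nat
  | tOne
  | tInv of term
  | tMul of term & term.

Inductive formula :=
  | fEq of term & term
  | fNot of formula
  | fAnd of formula & formula
  | fOr of formula & formula
  | fImp of formula & formula
  | fAll of nat & formula
  | fEx of nat & formula.

Fixpoint term_vars (t : term) : seq nat :=
  match t with
  | tVar i => [:: i]
  | tOne => [::]
  | tInv t1 => term_vars t1
  | tMul t1 t2 => term_vars t1 ++ term_vars t2
  end.

Fixpoint free_vars (f : formula) : seq nat :=
  match f with
  | fEq t1 t2 => term_vars t1 ++ term_vars t2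
  | fNot f1 => free_vars f1
  | fAnd f1 f2 | fOr f1 f2 | fImp f1 f2 => free_vars f1 ++ free_vars f2
  | fAll i f1 | fEx i f1 => [seq j <- free_vars f1 | j != i]
  end.

Definition sentence (f : formula) : bool := nilp (free_vars f).

Fixpoint quantifier_free (f : formula) : bool :=
  match f with
  | fEq _ _ => true
  | fNot f1 => quantifier_free f1
  | fAnd f1 f2 | fOr f1 f2 | fImp f1 f2 =>
      quantifier_free f1 && quantifier_free f2
  | fAll _ _ | fEx _ _ => false
  end.

(* A baseGroupType is a type with a binary operation, a unary operation and a
   constant, subject to no axioms: it is exactly a first-order structure for
   the language of groups. *)
Fixpoint teval (A : baseGroupType) (e : nat -> A) (t : term) : A :=
  match t with
  | tVar i => e i
  | tOne => 1%g
  | tInv t1 => (teval e t1)^-1%g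
  | tMul t1 t2 => (teval e t1 * teval e t2)%g
  end.

Definition update (A : Type) (e : nat -> A) (i : nat) (a : A) : nat -> A :=
  fun j => if j == i then a else e j.

Fixpoint holds (A : baseGroupType) (e : nat -> A) (f : formula) : Prop :=
  match f with
  | fEq t1 t2 => teval e t1 = teval e t2
  | fNot f1 => ~ holds e f1
  | fAnd f1 f2 => holds e f1 /\ holds e f2
  | fOr f1 f2 => holds e f1 \/ holds e f2
  | fImp f1 f2 => holds e f1 -> holds e f2
  | fAll i f1 => forall a : A, holds (update e i a) f1
  | fEx i f1 => exists a : A, holds (update e i a) f1
  end.

(* For a sentence the choice of the assignment is immaterial. *)
Definition true_in (A : baseGroupType) (f : formula) : Prop :=
  forall e : nat -> A, holds e f.

Definition logically_equivalent (f g : formula) : Prop :=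
  forall (A : baseGroupType) (e : nat -> A), holds e f <-> holds e g.

Definition pi2_sentence (f : formula) : Prop :=
  sentence f /\
  exists (xs ys : seq nat) (psi : formula),
    [/\ uniq (xs ++ ys), quantifier_free psi,
        {subset free_vars psi <= xs ++ ys}
      & logically_equivalent f (foldr fAll (foldr fEx psi ys) xs)].

Definition elementarily_equivalent (A B : baseGroupType) : Prop :=
  forall f : formula, sentence f -> (true_in A f <-> true_in B f).

(* The free group on T is realized by reduced words; the letter (t, true)
   stands for t and (t, false) for its inverse. *)
Section FreeGroup.
Variable T : choiceType.

Definition letter : Type := (T * bool)%type.
HB.instance Definition _ := Choice.on letter.

Implicit Types (l : letter) (w : seq letter).

Definition letter_inv l : letter := (l.1, ~~ l.2).

Definition reduced w : bool := sorted (fun l l' => l' != letter_inv l) w.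

Definition push l w : seq letter :=
  if w is l' :: w' then if l' == letter_inv l then w' else l :: w else [:: l].

Record free_group := FreeGroup { word : seq letter; _ : reduced word }.
HB.instance Definition _ := [isSub for word].
HB.instance Definition _ := [Choice of free_group by <:].

Lemma letter_invK : involutive letter_inv.
Proof. by case=> t b; rewrite /letter_inv /= negbK. Qed.

Lemma push_reduced l w : reduced w -> reduced (push l w).
Proof.
case: w => [|l' w] //= rw; case: ifP => [_|/negbT nl] /=; last by rewrite nl.
by move: rw; apply: path_sorted.
Qed.

Lemma pushes_reduced u v : reduced v -> reduced (foldr push v u).
Proof. by move=> rv; elim: u => //= l u; apply: push_reduced. Qed.

Lemma pushK l w : reduced w -> push (letter_inv l) (push l w) = w.
Proof.
case: w => [|l' w] /=; first by rewrite letter_invK eqxx.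
case: (eqVneq l' (letter_inv l)) => [->|nl] /= rw; last first.
  by rewrite letter_invK eqxx.
case: w rw => [|l2 w] //= /andP[nl _].
by rewrite (negbTE nl).
Qed.

Lemma pushVK l w : reduced w -> push l (push (letter_inv l) w) = w.
Proof. by move=> rw; rewrite -{1}[l]letter_invK pushK. Qed.

Lemma foldr_push l u v :
  reduced v -> foldr push v (push l u) = push l (foldr push v u).
Proof.
move=> rv; case: u => [|l' u] //=; case: eqP => [->|//].
by rewrite pushVK // pushes_reduced.
Qed.

Lemma foldr_reduced u : reduced u -> foldr push [::] u = u.
Proof.
elim: u => [|l u IHu] //= ru; rewrite IHu; last exact: path_sorted ru.
by case: u ru {IHu} => [|l' u] //= /andP[/negbTE->].
Qed.

Lemma reduced_inv w : reduced w -> reduced (rev (map letter_inv w)).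
Proof.
rewrite /reduced rev_sorted sorted_map; apply: sub_sorted => l l' /=.
by rewrite letter_invK eq_sym.
Qed.

Lemma wordP (x : free_group) : reduced (word x). Proof. exact: valP. Qed.

Definition free_one : free_group := @FreeGroup [::] isT.
Definition free_inv (x : free_group) : free_group :=
  FreeGroup (reduced_inv (wordP x)).
Definition free_mul (x y : free_group) : free_group :=
  FreeGroup (pushes_reduced (word x) (wordP y)).

Lemma free_mulA : associative free_mul.
Proof.
move=> x y z; apply: val_inj => /=; elim: (word x) => //= l u ->.
by rewrite foldr_push // wordP.
Qed.

Lemma free_mul1 : left_id free_one free_mul.
Proof. by move=> x; apply: val_inj. Qed.

Lemma free_mulr1 : right_id free_one free_mul.
Proof. by move=> x; apply: val_inj => /=; rewrite foldr_reduced // wordP. Qed.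

Lemma free_mulV : left_inverse free_one free_inv free_mul.
Proof.
move=> x; apply: val_inj => /=; case: x => w rw /=.
elim: w rw => [|l w IHw] // rlw /=.
have rw : reduced w by exact: path_sorted rlw.
rewrite rev_cons foldr_rcons.
have -> : l :: w = push l w by case: w rlw {IHw rw} => [|l' w] //= /andP[/negbTE->].
by rewrite pushK // IHw.
Qed.

Lemma free_mulrV : right_inverse free_one free_inv free_mul.
Proof.
have invK : involutive free_inv.
  case=> w rw; apply: val_inj => /=; rewrite map_rev revK -map_comp.
  by rewrite (eq_map (g := id)) ?map_id // => l; apply: letter_invK.
by move=> x; rewrite -{1}[x]invK free_mulV.
Qed.

HB.instance Definition _ := isGroup.Build free_group
  free_mulA free_mul1 free_mulr1 free_mulV free_mulrV.

Definition free_gen (t : T) : free_group := @FreeGroup [:: (t, true)] isT.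

(* The universal property, which characterizes free_group T as the free group
   with basis free_gen. *)
Lemma free_group_universal (H : groupType) (h : T -> H) :
  exists! phi : free_group -> H,
    {morph phi : x y / (x * y)%g} /\ forall t, phi (free_gen t) = h t.
Proof.
pose k l : H := (if l.2 then h l.1 else (h l.1)^-1)%g.
pose ev w : H := foldr (fun l a => k l * a)%g 1%g w.
have kV l : k (letter_inv l) = (k l)^-1%g.
  by case: l => t []; rewrite /k //= invgK.
have evp l w : ev (push l w) = (k l * ev w)%g.
  case: w => [|l' w] //=; case: eqP => [->|//].
  by rewrite kV mulVKg.
have evM u v : ev (foldr push v u) = (ev u * ev v)%g.
  by elim: u => [|l u IHu] /=; rewrite ?mul1g // evp IHu mulgA.
exists (fun x => ev (word x)); split.
  split=> [x y|t]; first exact: evM.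
  by rewrite /= mulg1.
move=> phi [phiM phiG]; apply/funext => -[w rw] /=.
have phi1 : phi 1%g = 1%g by apply: (mulgI (phi 1%g)); rewrite -phiM !mulg1.
have phiV x : phi x^-1%g = (phi x)^-1%g.
  by apply: (mulgI (phi x)); rewrite -phiM !mulgV phi1.
elim: w rw => [|l w IHw] rlw.
  by rewrite /= -phi1; congr phi; apply: val_inj.
have rw : reduced w by exact: path_sorted rlw.
have rl : reduced [:: l] by [].
have -> : FreeGroup rlw = (FreeGroup rl * FreeGroup rw)%g.
  by apply: val_inj => /=; case: w rlw {IHw rw} => [|l' w] //= /andP[/negbTE->].
rewrite phiM -IHw; congr (_ * _)%g.
case: l {rlw} rl => t [] rl; rewrite /k /= -phiG -?phiV; congr phi;
  exact: val_inj.
Qed.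

End FreeGroup.

Definition F2 : groupType := free_group bool.

Definition almost_locally_free (G : groupType) : Prop :=
  forall f : formula, pi2_sentence f -> true_in F2 f -> true_in G f.

(* Subgroups are boolean predicates closed under the group operations; with
   classical choice (boolp) this covers all subgroups. *)
Section Subgroup.
Variables (G : groupType) (M : groupClosed G).

Definition subgroup_type : Type := {x : G | x \in M}.
HB.instance Definition _ := SubChoice.on subgroup_type.

Lemma subgroup_closed : group_closed M.
Proof.
by split=> [|x y xM yM]; [exact: gpred1 | rewrite gpredM // gpredV].
Qed.

HB.instance Definition _ :=
  SubChoice_isSubGroup.Build G _ subgroup_type subgroup_closed.

Definition abelian_subgroup : Prop := {in M &, forall x y : G, commute x y}.

End Subgroup.

Definition maximal_abelian (G : groupType) (M : groupClosed G) : Prop :=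
  abelian_subgroup M /\
  forall N : groupClosed G,
    abelian_subgroup N -> {subset M <= N} -> {subset N <= M}.

Section Localization.
Import GRing.Theory.
Local Open Scope ring_scope.
Variable S : nat_pred.

(* The subring of rat generated by the integers and the 1/p for p in S. *)
Definition Zinv_pred : {pred rat} := fun x =>
  `[< forall A : subringClosed rat,
        (forall z : int, z%:~R \in A) ->
        (forall p : nat, p \in S -> p%:R^-1 \in A) -> x \in A >].

Lemma Zinv_closed : subring_closed Zinv_pred.
Proof.
split=> [|x y /asboolP xP /asboolP yP|x y /asboolP xP /asboolP yP];
  apply/asboolP => A AZ AS; first exact: rpred1.
- by rewrite rpredB ?xP ?yP.
- by rewrite rpredM ?xP ?yP.
Qed.

Definition Zinv : Type := {x : rat | x \in Zinv_pred}.
HB.instance Definition _ := SubChoice.on Zinv.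
HB.instance Definition _ :=
  GRing.SubChoice_isSubComNzRing.Build rat _ Zinv Zinv_closed.

End Localization.

(* The additive group of Z[S^-1], written multiplicatively. *)
Definition Zinv_group (S : nat_pred) : groupType := Algebra.to_multiplicative (Zinv S).

(* Main.v *)
Require Import Defs.
From HB Require Import structures.
From mathcomp Require Import all_boot all_order all_algebra.
From mathcomp Require Import boolp zify ring.

Set Implicit Arguments.
Unset Strict Implicit.
Unset Printing Implicit Defensive.

(** The centralizer of a nontrivial element of a free group is infinite cyclic. Being
    cyclic is not a first-order property, but these consequences of it are
    expressed by universal-existential sentences, so they hold in every almost
    locally free group: powers of nontrivial elements are nontrivial
    ([alf_torsion_free]), commuting is transitive on the nontrivial elements
    ([alf_commute_trans]), and, for each prime [p], if [x] and [y] commute then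
    [y] or some [x * y ^+ s] is a [p]-th power of an element that commutes with
    both ([alf_commute_root]). By the second property a maximal abelian subgroup
    M is the centralizer of each of its nontrivial elements, so the roots given
    by the third one lie in M. Hence M is a nontrivial torsion-free abelian group
    such that M/pM is cyclic for every prime p
    ([maximal_abelian_Szmielew_class]). For S the set of the primes p with
    M = pM, the group Z[1/S] is of the same kind with the same p
    ([Zinv_Szmielew_class]).

    It remains to see that two such groups A and B with the same S are
    elementarily equivalent, which is an instance of Szmielew's classification
    of abelian groups up to elementary equivalence
    ([Szmielew_elementarily_equivalent]). The proof is a back-and-forth argument
    with finite precision. For each L the quotients A/LA and B/LB are cyclic of
    the same order; choose generators of both. A position of the game is a pair
    of assignments that satisfy the same linear relations with coefficients at
    most N and have the same residues modulo L with respect to the generators. A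
    move [x] in A is answered as follows ([similar_step]). If [x] satisfies a
    relation over the values assigned so far, then the same relation can be solved
    in B, the residues showing that the required division is possible. Otherwise
    any element with the right residue will do that avoids finitely many values.
    Each move lowers the precision, but a formula has finitely many quantifiers,
    so enough precision at the start decides its truth ([preserved_exists]); and
    the zero assignments agree to any precision.

    In the free group the facts on commuting elements come from the free monoid.
    After a conjugation one of the two elements is a cyclically reduced word, and
    then it commutes as a word with the other element or with its inverse
    ([commute_cyclically_reduced]); commuting words are powers of a common
    word ([common_root]). *)

(** * Commuting words *)

Section Words.
Variable T : eqType.
Implicit Types u v w : seq T.

Definition wpow w n : seq T := flatten (nseq n w).

Lemma wpowD w m n : wpow w (m + n) = wpow w m ++ wpow w n.
Proof. by rewrite /wpow nseqD flatten_cat. Qed.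

Lemma wpow_catC u v n : u ++ v = v ++ u -> wpow u n ++ v = v ++ wpow u n.
Proof.
by move=> uv; elim: n => [|n IHn]; rewrite ?cats0 //= -catA IHn catA uv -catA.
Qed.

Lemma size_wpow w n : size (wpow w n) = n * size w.
Proof. by elim: n => //= n IHn; rewrite size_cat IHn. Qed.

(** Euclid's algorithm on the lengths: the shorter word is a prefix of the
    longer one, and cancelling it leaves a shorter commuting pair. *)
Lemma common_root u v :
  u ++ v = v ++ u -> exists w m n, u = wpow w m /\ v = wpow w n.
Proof.
move: {2}(size u + size v).+1 (ltnSn (size u + size v)) => k.
elim: k u v => // k IHk u v.
wlog le_uv : u v / size u <= size v => [wl|].
  case/orP: (leq_total (size u) (size v)) => [/wl//|le_vu lt_k uv].
  rewrite addnC in lt_k; have [w [m [n [-> ->]]]] := wl v u le_vu lt_k (esym uv).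
  by exists w, n, m.
case: (posnP (size u)) => [/size0nil-> _ _|u0 lt_k uv].
  by exists v, 0, 1; rewrite /wpow /= cats0.
have Ev : v = u ++ drop (size u) v.
  rewrite -{1}(cat_take_drop (size u) v); congr (_ ++ _).
  by move/(congr1 (take (size u))): uv; rewrite take_size_cat // takel_cat.
move: (drop _ _) Ev le_uv lt_k uv => v' -> _ lt_k uv.
case: (IHk u v') => [||w [m [n [-> ->]]]].
- by move: lt_k; rewrite size_cat; lia.
- by move/eqP: uv; rewrite -catA eqseq_cat // eqxx => /eqP.
by exists w, m, (m + n); rewrite wpowD.
Qed.

(** Both [v ++ w] and [w ++ v] are the prefix of length [size v + size w] of
    the infinite word u u u ... *)
Lemma cat_commute_trans u v w : 0 < size u ->
  u ++ v = v ++ u -> u ++ w = w ++ u -> v ++ w = w ++ v.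
Proof.
move=> u0 uv uw; pose n := size v + size w.
have E x : size x = n -> u ++ x = x ++ u -> x = take n (wpow u n).
  move=> sx ux; have le_n : n <= size (wpow u n) by rewrite size_wpow leq_pmulr.
  by rewrite -(takel_cat x le_n) wpow_catC // take_size_cat.
rewrite [LHS]E ?size_cat //; last by rewrite catA uv -catA uw catA.
by rewrite [RHS]E // ?size_cat 1?addnC // catA uw -catA uv catA.
Qed.

End Words.

(** * Centralizers in a free group *)

Section FreeWords.
Variable T : choiceType.
Local Open Scope group_scope.
Implicit Types (x y z : free_group T) (u v w : seq (letter T)).

Definition of_word w : free_group T := FreeGroup (pushes_reduced w (isT : reduced [::])).

Lemma of_wordK x : of_word (word x) = x.
Proof. by apply: val_inj; rewrite /= foldr_reduced // wordP. Qed.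

Lemma of_word_cat u v : of_word (u ++ v) = of_word u * of_word v.
Proof.
apply: val_inj; rewrite /= foldr_cat.
elim: u => //= l u ->; rewrite foldr_push //; exact: pushes_reduced.
Qed.

Lemma of_word_wpow w n : of_word (wpow w n) = of_word w ^+ n.
Proof. by elim: n => [|n IHn]; [exact: val_inj | rewrite expgS -IHn -of_word_cat]. Qed.

Lemma word_inj : injective (@word T).
Proof. exact: val_inj. Qed.

Lemma word_eq0 x : word x = [::] -> x = 1.
Proof. by move=> x0; apply: word_inj. Qed.

Definition winv w := rev (map (@letter_inv T) w).

Lemma word_inv x : word x^-1 = winv (word x). Proof. by []. Qed.

Lemma size_push l w : size (push l w) <= (size w).+1.
Proof. by case: w => //= l' w; case: ifP => _ //=; lia. Qed.

Lemma size_pushes u v : size (foldr (@push T) v u) <= size u + size v.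
Proof. by elim: u => //= l u IHu; apply: leq_trans (size_push _ _) _. Qed.

Lemma pushes_cat u v : size (foldr (@push T) v u) = size u + size v ->
  foldr (@push T) v u = u ++ v.
Proof.
elim: u => //= l u IHu E.
have := size_push l (foldr (@push T) v u); have := size_pushes u v => le1 le2.
rewrite -IHu; last lia.
case: (foldr _ v u) E le1 le2 => //= l' w; case: ifP => // _; lia.
Qed.

(** A reduced word that conjugation cannot shorten. *)
Definition cyclically_reduced w :=
  if w is l :: w' then last l w' != letter_inv l else true.

Lemma reduced_cat l u l' v : reduced (l :: u) -> reduced (l' :: v) ->
  l' != letter_inv (last l u) -> reduced ((l :: u) ++ l' :: v).
Proof. by rewrite /reduced /= cat_path /= => -> -> ->. Qed.

Lemma word_mul x y : reduced (word x ++ word y) -> word (x * y) = word x ++ word y.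
Proof.
move=> r; have -> : x * y = of_word (word x ++ word y) by rewrite of_word_cat !of_wordK.
exact: foldr_reduced.
Qed.

(** If the product [x * y] has no cancellation then, the lengths being equal,
    neither has [y * x]. *)
Lemma commute_words x y : reduced (word x ++ word y) -> x * y = y * x ->
  word x ++ word y = word y ++ word x.
Proof.
move=> r xy; rewrite -word_mul // xy; apply: pushes_cat.
by rewrite -[LHS]/(size (word (y * x))) -xy word_mul // size_cat addnC.
Qed.

(** The products [x * y] and [x^-1 * y] cannot both have cancellation: the first
    letter of [y] would be the inverse of the last letter of [x] and also the
    first letter of [x], which cyclic reduction excludes. So [commute_words]
    applies to [x] or to [x^-1]; in the latter case inverting the words moves the
    inverse to [y]. *)
Lemma commute_cyclically_reduced x y : cyclically_reduced (word x) -> x * y = y * x ->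
  exists2 y', y' = y \/ y' = y^-1 & word x ++ word y' = word y' ++ word x.
Proof.
case Ex: (word x) => [|l u] cr xy; first by exists y; [left | rewrite cats0].
case Ey: (word y) => [|l' v]; first by exists y; [left | rewrite Ey cats0].
have rx : reduced (l :: u) by rewrite -Ex wordP.
have ry : reduced (l' :: v) by rewrite -Ey wordP.
have [E|N] := eqVneq l' (letter_inv (last l u)); last first.
  by exists y; [left | rewrite -Ex; apply: commute_words => //; rewrite Ex Ey reduced_cat].
exists y^-1; first by right.
have xVy : x^-1 * y = y * x^-1 by apply/esym/commuteV.
have rVy : reduced (word x^-1 ++ word y).
  have Exi : word x^-1 = rcons (winv u) (letter_inv l).
    by rewrite word_inv Ex /winv /= rev_cons.
  have : reduced (word x^-1) by apply: wordP.
  rewrite Exi Ey; case: (winv u) => [|l1 u1] //= ru.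
    by apply: (@reduced_cat _ [::]); rewrite //= letter_invK E (inv_eq (@letter_invK T)).
  apply: (@reduced_cat l1 (rcons u1 (letter_inv l))) => //.
  by rewrite last_rcons letter_invK E (inv_eq (@letter_invK T)).
have := congr1 winv (commute_words rVy xVy).
by rewrite /winv !map_cat !rev_cat -!/(winv _) -!word_inv invgK Ex.
Qed.

(** Conjugating by the first letter shortens a word that is not cyclically
    reduced. *)
Lemma cyclically_reduced_conj x : exists g, cyclically_reduced (word (x ^ g)).
Proof.
move: {2}(size (word x)).+1 (ltnSn (size (word x))) => k.
elim: k x => // k IHk x lt_k.
case cr: (cyclically_reduced (word x)); first by exists 1; rewrite conjg1.
case Ex: (word x) cr lt_k => [|l w] //=; case/lastP: w Ex => [|w l'] Ex.
  by rewrite /= eqE /= /pair_eq /= eqxx; case: l.2.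
rewrite last_rcons => /negbFE/eqP El' lt_k.
have Exg : x = of_word [:: l] * of_word w * (of_word [:: l])^-1.
  rewrite -[x]of_wordK Ex El' -cats1 -cat1s !of_word_cat mulgA; congr (_ * _).
  exact: word_inj.
have Ec : x ^ of_word [:: l] = of_word w by rewrite conjgE {1}Exg !mulgA mulgVK mulVg mul1g.
have [|g crg] := IHk (x ^ of_word [:: l]).
  rewrite Ec; apply: leq_ltn_trans (size_pushes w [::]) _.
  by move: lt_k; rewrite size_rcons /=; lia.
by exists (of_word [:: l] * g); move: crg; rewrite -conjgM.
Qed.

Lemma free_commute_powers x y : x * y = y * x ->
  exists z m n, x = z ^+ m /\ (y = z ^+ n \/ y = z ^- n).
Proof.
move=> xy; have [g cr] := cyclically_reduced_conj x.
have xyg : x ^ g * y ^ g = y ^ g * x ^ g by rewrite -!conjMg xy.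
have [y' Ey' /common_root[w [m [n [Ex Ew]]]]] := commute_cyclically_reduced cr xyg.
have {}Ex : x ^ g = of_word w ^+ m by rewrite -[LHS]of_wordK Ex of_word_wpow.
have {}Ew : y' = of_word w ^+ n by rewrite -[LHS]of_wordK Ew of_word_wpow.
exists (of_word w ^ g^-1), m, n; rewrite -!conjXg -conjVg -Ex -Ew conjgK; split=> //.
by case: Ey' => ->; rewrite ?invgK conjgK; [left | right].
Qed.

(** For a cyclically reduced [x] this is transitivity in the free monoid. *)
Lemma free_commute_trans x y z : x <> 1 ->
  x * y = y * x -> x * z = z * x -> y * z = z * y.
Proof.
move=> x1 xy xz; have [g cr] := cyclically_reduced_conj x.
have xyg : x ^ g * y ^ g = y ^ g * x ^ g by rewrite -!conjMg xy.
have xzg : x ^ g * z ^ g = z ^ g * x ^ g by rewrite -!conjMg xz.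
have x0 : 0 < size (word (x ^ g)).
  rewrite lt0n; apply/eqP => /size0nil/word_eq0/eqP.
  by rewrite conjg_eq1 => /eqP.
have [y' Ey' wy] := commute_cyclically_reduced cr xyg.
have [z' Ez' wz] := commute_cyclically_reduced cr xzg.
have yz' : commute y' z'.
  by rewrite /commute -[y']of_wordK -[z']of_wordK -!of_word_cat (cat_commute_trans x0 wy wz).
suff: commute (y ^ g) (z ^ g) by rewrite /commute -!conjMg => /conjg_inj.
have Vc (a b : free_group T) : commute a b -> commute a b^-1 by apply: commuteV.
case: Ey' Ez' => [<-|E1] [<-|E2] //.
- by rewrite -[z ^ g]invgK -E2; apply: Vc.
- by rewrite -[y ^ g]invgK -E1; apply/commute_sym/Vc/commute_sym.
rewrite -[y ^ g]invgK -[z ^ g]invgK -E1 -E2.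
by apply/Vc/commute_sym/Vc/commute_sym.
Qed.

(** The powers of a cyclically reduced word are formed without cancellation. *)
Lemma free_torsion_free x n : 0 < n -> x ^+ n = 1 -> x = 1.
Proof.
have [g cr] := cyclically_reduced_conj x => n0 xn.
apply/eqP; rewrite -(conjg_eq1 x g); apply/eqP/word_eq0.
have {xn} : (x ^ g) ^+ n = 1 by rewrite -conjXg xn conj1g.
move: cr; set y := x ^ g; case Ey: (word y) => [|l u] //= cr yn.
suff E m : word (y ^+ m) = wpow (l :: u) m.
  by have := congr1 (@word T) yn; rewrite E; case: n n0 {yn}.
elim: m => // m IHm; rewrite expgS word_mul IHm Ey //.
have ry : reduced (l :: u) by rewrite -Ey wordP.
case: m IHm => [|m] IHm; first by rewrite cats0.
rewrite /wpow /=; apply: reduced_cat => //.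
  by rewrite -[_ :: _]/(wpow (l :: u) m.+1) -IHm wordP.
by rewrite eq_sym (inv_eq (@letter_invK T)).
Qed.

End FreeWords.

(** * Transfer of universal-existential sentences *)

Lemma free_vars_foldr_All f xs j :
  (j \in free_vars (foldr fAll f xs)) = (j \in free_vars f) && (j \notin xs).
Proof.
elim: xs => [|i xs IHxs]; rewrite ?andbT //= mem_filter IHxs inE negb_or.
by rewrite andbCA.
Qed.

Lemma free_vars_foldr_Ex f xs j :
  (j \in free_vars (foldr fEx f xs)) = (j \in free_vars f) && (j \notin xs).
Proof.
elim: xs => [|i xs IHxs]; rewrite ?andbT //= mem_filter IHxs inE negb_or.
by rewrite andbCA.
Qed.

(** The sentences used below are given in prenex form, where the conditions of
    [pi2_sentence] are checked by computation. *)
Lemma pi2_transfer (G : groupType) xs ys psi : almost_locally_free G ->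
  uniq (xs ++ ys) -> quantifier_free psi ->
  all [in xs ++ ys] (free_vars psi) ->
  true_in F2 (foldr fAll (foldr fEx psi ys) xs) ->
  true_in G (foldr fAll (foldr fEx psi ys) xs).
Proof.
move=> hG xys qf /allP sub; apply: hG; split; last by exists xs, ys, psi; split.
rewrite /sentence; case E: (free_vars _) => [//|j s]; exfalso.
have : j \in free_vars (foldr fAll (foldr fEx psi ys) xs) by rewrite E mem_head.
rewrite free_vars_foldr_All free_vars_foldr_Ex => /andP[/andP[/sub]].
by rewrite mem_cat => /orP[->|->].
Qed.

Definition tPow (t : term) n : term := iter n (tMul t) tOne.

Lemma teval_pow (A : groupType) (e : nat -> A) t n :
  teval e (tPow t n) = (teval e t ^+ n)%g.
Proof. by elim: n => //= n ->; rewrite expgS. Qed.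

Lemma all_term_vars_pow V t n : all V (term_vars t) -> all V (term_vars (tPow t n)).
Proof. by move=> Vt; elim: n => //= n IHn; rewrite all_cat Vt. Qed.

Definition fOrs (fs : seq formula) : formula := foldr fOr (fNot (fEq tOne tOne)) fs.

Lemma holds_ors (T : eqType) (A : baseGroupType) (e : nat -> A) (F : T -> formula) s :
  holds e (fOrs (map F s)) <-> exists2 i, i \in s & holds e (F i).
Proof.
elim: s => [|i s IHs] /=; first by split=> [/(_ erefl)|[]].
rewrite IHs; split=> [[hi|[j js hj]]|[j]].
- by exists i; rewrite ?mem_head.
- by exists j; rewrite // inE js orbT.
by rewrite inE => /orP[/eqP->|js hj]; [left | right; exists j].
Qed.

Lemma quantifier_free_ors (T : Type) (F : T -> formula) s :
  (forall i, quantifier_free (F i)) -> quantifier_free (fOrs (map F s)).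
Proof. by move=> qf; elim: s => //= i s ->; rewrite qf. Qed.

Lemma all_free_vars_ors (T : Type) (F : T -> formula) s V :
  (forall i, all V (free_vars (F i))) -> all V (free_vars (fOrs (map F s))).
Proof. by move=> VF; elim: s => //= i s IHs; rewrite all_cat VF. Qed.

Local Open Scope group_scope.

Lemma prime_solve p n m : prime p -> ~~ (p %| n)%N ->
  exists2 b, (b < p)%N & (p %| m + b * n)%N.
Proof.
move=> pr_p npn; have p0 := prime_gt0 pr_p.
have /eqP co : coprime p n by rewrite prime_coprime.
have [a _] := Bezoutl n p0; rewrite co => pa.
exists ((m * a) %% p)%N; first by rewrite ltn_mod.
have : (p %| m * (1 + a * n))%N by rewrite dvdn_mull.
by rewrite mulnDr muln1 mulnA /dvdn -modnDmr -modnMml modnDmr.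
Qed.

(** Up to the sign of the exponent of [y], let [x = z ^+ m] and [y = z ^+ n]. The
    root is a power of [z]; if [p] does not divide [n], the exponent [b] solves
    [m + b * n = 0] modulo [p]. *)
Lemma free_commute_root (T : choiceType) p (x y : free_group T) :
  prime p -> x * y = y * x ->
  exists t, [/\ t * x = x * t, t * y = y * t
    & y = t ^+ p \/ exists2 b, (b < p)%N & x * y ^+ b = t ^+ p \/ x * y ^- b = t ^+ p].
Proof.
move=> pr_p /free_commute_powers[z [m [n [Ex Ey]]]].
suff [t [zt Et]] : exists t, commute z t /\ (z ^+ n = t ^+ p \/
    exists2 b, (b < p)%N & x * (z ^+ n) ^+ b = t ^+ p).
  have xt : x * t = t * x by rewrite Ex; apply/commute_sym/commuteX/commute_sym.
  have znt : commute (z ^+ n) t by apply/commute_sym/commuteX/commute_sym.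
  have yt : y * t = t * y.
    by case: Ey => ->; [exact: znt | apply/commute_sym/commuteV/commute_sym].
  case: Ey => Ey.
    exists t; split=> //; case: Et => [|[b lt_b Et]]; rewrite -?Ey; first by left.
    by right; exists b => //; left; rewrite Ey.
  case: Et => [Et|[b lt_b Et]].
    exists t^-1; split; [exact/esym/commuteV | exact/esym/commuteV |].
    by left; rewrite Ey Et expVgn.
  by exists t; split=> //; right; exists b => //; right; rewrite Ey -expVgn invgK.
case pn: (p %| n)%N.
  exists (z ^+ (n %/ p)); split; first exact: commuteX.
  by left; rewrite -expgnA divnK.
have [b lt_b pb] := prime_solve m pr_p (negbT pn).
exists (z ^+ ((m + b * n) %/ p)); split; first exact: commuteX.
by right; exists b; rewrite // -[RHS]expgnA divnK // expgnDr Ex mulnC expgnA.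
Qed.

Section AlmostLocallyFree.
Variables (G : groupType) (hG : almost_locally_free G).

Lemma alf_nontrivial : exists x : G, x <> 1.
Proof.
have /(_ (fun=> 1))[x x1] :
    true_in G (foldr fAll (foldr fEx (fNot (fEq (tVar 0) tOne)) [:: 0]) [::]).
  by apply: pi2_transfer => // e; exists (free_gen true).
by exists x.
Qed.

Lemma alf_torsion_free (x : G) n : (0 < n)%N -> x ^+ n = 1 -> x = 1.
Proof.
move=> n0; pose psi := fImp (fEq (tPow (tVar 0) n) tOne) (fEq (tVar 0) tOne).
have /(_ (fun=> 1) x) : true_in G (foldr fAll (foldr fEx psi [::]) [:: 0]).
  apply: pi2_transfer => // [|e y] /=.
    by rewrite !all_cat all_term_vars_pow.
  by rewrite teval_pow; apply: free_torsion_free.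
by rewrite /= teval_pow.
Qed.

Lemma alf_commute_trans (x y z : G) : x <> 1 ->
  x * y = y * x -> x * z = z * x -> y * z = z * y.
Proof.
pose comm i j := fEq (tMul (tVar i) (tVar j)) (tMul (tVar j) (tVar i)).
pose psi := fImp (fNot (fEq (tVar 0) tOne)) (fImp (comm 0 1) (fImp (comm 0 2) (comm 1 2)))%N.
have /(_ (fun=> 1) x y z)// : true_in G (foldr fAll (foldr fEx psi [::]) [:: 0; 1; 2]%N).
by apply: pi2_transfer => // e x' y' z'; apply: free_commute_trans.
Qed.

(** The disjunction over [b < p] makes the sentence first-order; the two signs
    of the exponent of [y] spare a case distinction on how the generator of the
    centralizer is oriented. *)
Lemma alf_commute_root p (x y : G) : prime p -> x * y = y * x ->
  exists t, [/\ t * x = x * t, t * y = y * t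
    & y = t ^+ p \/ exists b, x * y ^+ b = t ^+ p \/ x * y ^- b = t ^+ p].
Proof.
move=> pr_p; pose comm i j := fEq (tMul (tVar i) (tVar j)) (tMul (tVar j) (tVar i)).
pose tp := tPow (tVar 2) p; pose yb b := tPow (tVar 1%N) b.
pose F b := fOr (fEq (tMul (tVar 0) (yb b)) tp) (fEq (tMul (tVar 0) (tInv (yb b))) tp).
pose psi := fImp (comm 0 1)%N (fAnd (comm 2 0)%N
  (fAnd (comm 2 1)%N (fOr (fEq (tVar 1%N) tp) (fOrs (map F (iota 0 p)))))).
have /(_ (fun=> 1) x y) : true_in G (foldr fAll (foldr fEx psi [:: 2]) [:: 0; 1]%N).
  apply: pi2_transfer => //= [|| e x' y'].
  - by rewrite quantifier_free_ors.
  - rewrite !all_cat /= all_term_vars_pow //= all_free_vars_ors // => b.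
    by rewrite /= !all_cat /= !all_cat !all_term_vars_pow.
  have [xy|nxy] := EM (x' * y' = y' * x'); last by exists 1.
  have [t [tx ty Et]] := free_commute_root pr_p xy.
  exists t => _; do 2!split=> //; case: Et => [Et|[b lt_b Et]].
    by left; rewrite /= teval_pow.
  right; apply/holds_ors; exists b; first by rewrite mem_iota.
  by rewrite /= !teval_pow.
case=> t /= h xy; have [tx [ty Et]] := h xy; exists t; split=> //.
case: Et => [|/holds_ors[b _]]; rewrite /= !teval_pow; first by left.
by right; exists b.
Qed.

End AlmostLocallyFree.

(** * Torsion-free abelian groups with cyclic quotients modulo primes *)

Local Close Scope group_scope.
Import GRing.Theory Num.Theory.
Local Open Scope ring_scope.

Definition multiple (A : zmodType) (m : nat) (x : A) : Prop := exists t, x = t *+ m.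

(** The torsion-free groups with the Szmielew invariants of Z[1/S]: A/pA is
    trivial for p in S and of order p for the other primes. *)
Record Szmielew_class (S : nat_pred) (A : zmodType) : Prop := SzmielewClass {
  torsion_freeP : forall (x : A) n, (0 < n)%N -> x *+ n = 0 -> x = 0;
  nontrivialP : exists x : A, x <> 0;
  divisibleP : forall p (x : A), prime p -> p \in S -> multiple p x;
  indivisibleP : forall p, prime p -> p \notin S -> exists x : A, ~ multiple p x;
  cyclic_modP : forall p (x y : A), prime p ->
    multiple p y \/ exists s : int, multiple p (x + y *~ s)
}.

Lemma prime_mul_ind (P : nat -> Prop) : P 1%N ->
  (forall p m, prime p -> (0 < m)%N -> P m -> P (p * m)%N) ->
  forall n, (0 < n)%N -> P n.
Proof.
move=> P1 PM; elim/ltn_ind=> n IHn n0; case: (ltngtP n 1) => [|n1|->//]; first by lia.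
have p0 : (0 < n %/ pdiv n)%N by rewrite divn_gt0 ?pdiv_gt0 // pdiv_leq.
rewrite -(divnK (pdiv_dvd n)) mulnC; apply: PM => //; first exact: pdiv_prime.
by apply: IHn => //; rewrite ltn_Pdiv // prime_gt1 // pdiv_prime.
Qed.

Section Multiples.
Variable A : zmodType.
Implicit Types (x y : A) (m n : nat) (s : int).

Lemma multipleD m x y : multiple m x -> multiple m y -> multiple m (x + y).
Proof. by move=> [t ->] [u ->]; exists (t + u); rewrite mulrnDl. Qed.

Lemma multipleN m x : multiple m x -> multiple m (- x).
Proof. by move=> [t ->]; exists (- t); rewrite mulNrn. Qed.

Lemma multipleMz m x s : multiple m x -> multiple m (x *~ s).
Proof. by move=> [t ->]; exists (t *~ s); rewrite !pmulrn mulrzAC. Qed.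

Lemma multiple_dvd m n x : (m %| n)%N -> multiple n x -> multiple m x.
Proof. by move=> /dvdnP[q ->] [t ->]; exists (t *+ q); rewrite mulrnA. Qed.

Lemma multiple_self m x : multiple m (x *+ m). Proof. by exists x. Qed.

Lemma multiple_coprime m x s : coprimez m s -> multiple m (x *~ s) -> multiple m x.
Proof.
case/coprimezP=> -[u v] /= uv xs.
rewrite -[x]mulr1z -uv mulrzDr; apply: multipleD; last first.
  by rewrite mulrC mulrzA; apply: multipleMz.
by rewrite mulrzA; exact: multiple_self.
Qed.

Lemma multiple_prime p x s : prime p -> multiple p (x *~ s) ->
  multiple p x \/ (p %| s)%Z.
Proof.
move=> pr_p xs; case ps: (p %| s)%Z; first by right.
left; apply: multiple_coprime xs.
by rewrite coprimezE prime_coprime //; move: ps; rewrite dvdzE => ->.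
Qed.

End Multiples.

Section Generators.
Variable S : nat_pred.

(** For a group in the class these are the elements whose cosets generate A/LA,
    see [generator_modP]. *)
Definition generator_mod (A : zmodType) L (a : A) : Prop :=
  forall p, prime p -> (p %| L)%N -> p \notin S -> ~ multiple p a.

Variable A : zmodType.
Hypothesis hA : Szmielew_class S A.

Lemma mulrIz_tf (x : A) (s : int) : x *~ s = 0 -> x = 0 \/ s = 0.
Proof.
case: (intP s) => [|n|n]; first by right.
  by move/(torsion_freeP hA (ltn0Sn n)); left.
by rewrite mulrNz => /eqP; rewrite oppr_eq0 => /eqP/(torsion_freeP hA (ltn0Sn n)); left.
Qed.

Lemma multiple_cancel m n (x : A) : (0 < n)%N -> multiple (m * n) (x *+ n) -> multiple m x.
Proof.
move=> n0 [t E]; exists t; apply/eqP; rewrite -subr_eq0; apply/eqP.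
by apply: (torsion_freeP hA n0); rewrite mulrnBl E mulrnA subrr.
Qed.

(** By the Chinese remainder theorem: to an element that works for [m] and not
    for [p], add [m] times one that works for [p]. *)
Lemma generator_mod_exists L : (0 < L)%N -> exists a : A, generator_mod L a.
Proof.
elim/prime_mul_ind: L / => [|p m pr_p _ [a ga]].
  by exists 0 => p pr_p; rewrite dvdn1 => /eqP p1; rewrite p1 in pr_p.
have gpm b : (p \notin S -> ~ multiple p b) -> generator_mod m b -> generator_mod (p * m) b.
  move=> gp gm q pr_q; rewrite Euclid_dvdM // dvdn_prime2 // => /orP[/eqP->//|].
  exact: gm.
have [pS|pS] := boolP (p \in S); first by exists a; apply: gpm => //; rewrite pS.
have [pa|npa] := EM (multiple p a); last by exists a; apply: gpm.
have npm : ~~ (p %| m)%N by apply/negP => pm; apply: ga pa.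
have [b pb] := indivisibleP hA pr_p pS; exists (a + b *+ m); apply: gpm => [_ pab|].
  have : multiple p (b *~ m%:Z).
    by rewrite -[_ *~ _](addKr a); apply: multipleD => //; apply: multipleN.
  by case/(multiple_prime pr_p) => //; rewrite /dvdz /=; apply/negP.
move=> q pr_q qm qS qab; apply: (ga q) => //.
rewrite -[a](addrK (b *+ m)); apply: multipleD => //; apply/multipleN.
by apply: multiple_dvd qm _; exact: multiple_self.
Qed.

Lemma generator_mod_dvd L m (a : A) : (m %| L)%N -> generator_mod L a -> generator_mod m a.
Proof. by move=> mL ga p pr_p pm; apply: ga => //; apply: dvdn_trans mL. Qed.

Lemma generator_modP L (a x : A) : (0 < L)%N -> generator_mod L a ->
  exists k t, x = a *~ k + t *+ L.
Proof.
move=> L0; elim/prime_mul_ind: L / L0 x => [x _|p m pr_p m0 IHm x ga].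
  by exists 0, x; rewrite add0r.
have [|k [t ->]] := IHm x; first by apply: generator_mod_dvd ga; rewrite dvdn_mull.
suff [k' [u ->]] : exists k' u, t = a *~ k' + u *+ p.
  exists (k + k' * m%:Z), u.
  by rewrite mulrnDl mulrzDr addrA mulrzA pmulrn mulrnA pmulrn.
have [pS|pS] := boolP (p \in S).
  by have [u ->] := divisibleP hA t pr_p pS; exists 0, u; rewrite add0r.
have [/ga[]//|[s [u E]]] := cyclic_modP hA t a pr_p; first by rewrite dvdn_mulr.
by exists (- s), u; rewrite -E mulrNz addrC addrK.
Qed.

End Generators.

(** The order of a generator of A/mA depends only on [m] and on [S]. *)
Lemma generator_mod_order S (A B : zmodType) L (a : A) (b : B) m (s : int) :
  Szmielew_class S A -> Szmielew_class S B -> generator_mod S L a ->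
  (0 < m)%N -> (m %| L)%N -> multiple m (a *~ s) -> multiple m (b *~ s).
Proof.
move=> hA hB ga m0; elim/prime_mul_ind: m / m0 s => [s _ _|p m pr_p m0 IHm s mL ms].
  by exists (b *~ s).
have mL' : (m %| L)%N by apply: dvdn_trans mL; rewrite dvdn_mull.
have pL : (p %| L)%N by apply: dvdn_trans mL; rewrite dvdn_mulr.
have [pS|pS] := boolP (p \in S).
  have [|t ->] := IHm s mL'; first by apply: multiple_dvd ms; rewrite dvdn_mull.
  by have [u ->] := divisibleP hB t pr_p pS; exists u; rewrite mulrnA.
have : multiple p (a *~ s) by apply: multiple_dvd ms; rewrite dvdn_mulr.
case/(multiple_prime pr_p) => [/ga[]//|/dvdzP[s1 Es]].
have [|t E] := IHm s1 mL'.
  apply: (multiple_cancel hA (prime_gt0 pr_p)).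
  by rewrite mulnC pmulrn -mulrzA -Es.
by exists t; rewrite Es mulrzA E mulnC mulrnA.
Qed.

(** * The back-and-forth argument *)

Section LinearForms.
Variable A : zmodType.
Implicit Types (e : nat -> A) (c d : nat -> int) (K N i : nat).

Definition lin K e c : A := \sum_(j < K) e j *~ c j.

Definition bounded N c : Prop := forall j, (`|c j| <= N)%N.

Lemma linD K e c d : lin K e (fun j => c j + d j) = lin K e c + lin K e d.
Proof. by rewrite -big_split; apply: eq_bigr => j _; rewrite mulrzDr. Qed.

Lemma linMz K e c s : lin K e (fun j => c j * s) = lin K e c *~ s.
Proof. by rewrite /lin mulrz_suml; apply: eq_bigr => j _; rewrite mulrzA. Qed.

Lemma linB K e c d : lin K e (fun j => c j - d j) = lin K e c - lin K e d.
Proof. by rewrite -sumrB; apply: eq_bigr => j _; rewrite mulrzBr. Qed.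

Lemma lin_update K e i x c : (i < K)%N ->
  lin K (update e i x) c = x *~ c i + lin K e (update c i 0).
Proof.
move=> iK; rewrite /lin (bigD1 (Ordinal iK)) //= [in RHS](bigD1 (Ordinal iK)) //=.
rewrite /update eqxx mulr0z add0r; congr (_ + _); apply: eq_bigr => j.
by rewrite -val_eqE /= => /negbTE->.
Qed.

Lemma bounded_update N c i : bounded N c -> bounded N (update c i 0).
Proof. by move=> bc j; rewrite /update; case: eqP. Qed.

Lemma bounded_le M N c : (M <= N)%N -> bounded M c -> bounded N c.
Proof. by move=> le bc j; apply: leq_trans le. Qed.

Definition small_ints N : seq int :=
  [seq n%:Z | n <- iota 0 N.+1] ++ [seq - n%:Z | n <- iota 0 N.+1].

Lemma mem_small_ints N (s : int) : (`|s| <= N)%N -> s \in small_ints N.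
Proof.
move=> sN; rewrite mem_cat; apply/orP.
case: (intP s) sN => [|n|n] sN; [left | left | right]; apply/mapP.
- by exists 0%N.
- by exists n.+1; rewrite // mem_iota; lia.
by exists n.+1; rewrite // mem_iota; lia.
Qed.

Lemma lin_finite K N e : exists s : seq A, forall c, bounded N c -> lin K e c \in s.
Proof.
elim: K => [|K [s hs]]; first by exists [:: 0] => c _; rewrite /lin big_ord0 mem_head.
exists [seq v + e K *~ n | v <- s, n <- small_ints N] => c bc.
rewrite /lin big_ord_recr; apply/allpairsP; exists (lin K e c, c K).
by split; [exact: hs | exact/mem_small_ints/bc |].
Qed.

Lemma lin_residue K e c (a : A) (k : nat -> int) m :
  (forall j, (j < K)%N -> exists t, e j = a *~ k j + t *+ m) ->
  exists t, lin K e c = a *~ (\sum_(j < K) k j * c j) + t *+ m.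
Proof.
elim: K => [_|K IHK ek]; first by exists 0; rewrite /lin !big_ord0 mulr0z mul0rn addr0.
have [j jK|t Et] := IHK; first by apply/ek/leqW.
have [u Eu] := ek K (ltnSn K).
exists (t + u *~ c K); rewrite /lin !big_ord_recr /= -/(lin K e c) Et Eu.
by rewrite mulrzDl mulrzDr mulrnDl addrACA -!mulrzA !pmulrn -!mulrzA [m%:Z * _]mulrC.
Qed.

End LinearForms.

Lemma eventually_all (T : eqType) (s : seq T) (P : T -> nat -> Prop) :
  (forall x, x \in s -> exists n0, forall n, (n0 <= n)%N -> P x n) ->
  exists n, forall x, x \in s -> P x n.
Proof.
move=> ev; suff [n0 hn] : exists n0, forall n, (n0 <= n)%N -> forall x, x \in s -> P x n.
  by exists n0; apply: hn.
elim: s ev => [|y s IHs] ev; first by exists 0%N.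
have [n1 h1] := ev y (mem_head y s).
have [x xs|n2 h2] := IHs; first by apply: ev; rewrite inE xs orbT.
exists (maxn n1 n2) => n; rewrite geq_max => /andP[le1 le2] x.
by rewrite inE => /orP[/eqP->|]; [exact: h1 | exact: h2].
Qed.

(** A nonzero [w] has infinitely many multiples, and each linear condition
    excludes at most one of them. *)
Lemma avoid_values S (A : zmodType) (s : seq (A * int)) : Szmielew_class S A ->
  exists z : A, forall v n, (v, n) \in s -> n <> 0 -> v + z *~ n <> 0.
Proof.
move=> hA; have [w w0] := nontrivialP hA.
suff [n hn] : exists m : nat, forall x, x \in s -> x.2 <> 0 -> x.1 + w *+ m *~ x.2 <> 0.
  by exists (w *+ n) => v m /hn.
apply: eventually_all => -[v n] _ /=.
have [[m0 E]|none] := EM (exists m : nat, v + w *+ m *~ n = 0); last first.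
  by exists 0%N => m _ _ E; apply: none; exists m.
exists m0.+1 => m lt_m n0; rewrite -E => /addrI/eqP.
rewrite !pmulrn -!mulrzA -subr_eq0 -mulrzBr => /eqP/(mulrIz_tf hA)[//|].
by rewrite -mulrBl => /eqP; rewrite mulf_eq0 => /orP[|/eqP//]; lia.
Qed.

(** Cross-multiplying with the relation [n * x = - d] eliminates [x]. *)
Lemma lin_update_eliminate S (A : zmodType) K (e : nat -> A) i x (n : int) d c :
  Szmielew_class S A -> (i < K)%N -> n <> 0 -> x *~ n + lin K e d = 0 ->
  lin K (update e i x) c = 0 <->
  lin K e (fun j => update c i 0 j * n - d j * c i) = 0.
Proof.
move=> hA iK n0 Ex; rewrite linB !linMz lin_update //.
have -> : lin K e d = - (x *~ n) by apply/eqP; rewrite -addr_eq0 addrC Ex.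
rewrite mulNrz opprK mulrzAC -mulrzDl addrC.
by split=> [->|/(mulrIz_tf hA)[]//]; rewrite mul0rz.
Qed.

Lemma bounded_eliminate N c d (m n : int) : (`|m| <= N)%N -> (`|n| <= N)%N ->
  bounded N c -> bounded N d -> bounded (2 * N ^ 2) (fun j => c j * n - d j * m).
Proof.
move=> mN nN bc bd j; move: (bc j) (bd j); set x := c j; set y := d j => xN yN.
apply: leq_trans (leqD_dist _ 0 _) _; rewrite subr0 sub0r abszN !abszM.
have := leq_mul xN nN; have := leq_mul yN mN; lia.
Qed.

Section BackAndForth.
Variables (S : nat_pred) (K : nat).

(** Finite approximation of having the same first-order type. The same [k] on
    both sides means that the values correspond under the isomorphism from A/LA
    to B/LB that maps the class of [a] to that of [b]. *)
Definition similar (A B : zmodType) (a : A) (b : B) N L (eA : nat -> A) (eB : nat -> B) :=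
  (forall c, bounded N c -> lin K eA c = 0 <-> lin K eB c = 0) /\
  exists k : nat -> int, forall j, (j < K)%N ->
    (exists t, eA j = a *~ k j + t *+ L) /\ (exists t, eB j = b *~ k j + t *+ L).

Lemma similar_sym (A B : zmodType) (a : A) (b : B) N L eA eB :
  similar a b N L eA eB -> similar b a N L eB eA.
Proof.
move=> [hc [k hk]]; split=> [c bc|]; first by rewrite hc.
by exists k => j /hk[].
Qed.

Lemma similar_le (A B : zmodType) (a : A) (b : B) N N' L L' eA eB :
  (N <= N')%N -> (L %| L')%N -> similar a b N' L' eA eB -> similar a b N L eA eB.
Proof.
move=> le_N /dvdnP[q ->] [hc [k hk]]; split=> [c bc|].
  by apply: hc; apply: bounded_le bc.
exists k => j /hk[[t Et] [u Eu]].
by split; [exists (t *+ q) | exists (u *+ q)]; rewrite -mulrnA.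
Qed.

(** The bound [2 * N ^ 2] allows for cross-multiplying two relations, and the
    factor [N`!] for dividing by a coefficient of a relation. *)
Lemma similar_step (A B : zmodType) (a : A) (b : B) Lmax N L i eA eB x :
  Szmielew_class S A -> Szmielew_class S B ->
  generator_mod S Lmax a -> (0 < Lmax)%N -> (0 < N)%N -> (L * N`! %| Lmax)%N -> (i < K)%N ->
  similar a b (2 * N ^ 2) (L * N`!) eA eB ->
  exists y, similar a b N L (update eA i x) (update eB i y).
Proof.
move=> hA hB ga Lmax0 N0 LN iK [hc [k hk]].
have L'0 : (0 < L * N`!)%N by apply: dvdn_gt0 LN.
have L0 : (0 < L)%N by move: L'0; rewrite muln_gt0 => /andP[].
have dvdL : (L %| L * N`!)%N by apply: dvdn_mulr.
have leN : (N <= 2 * N ^ 2)%N by nia.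
have dvdLmax : (L %| Lmax)%N by apply: dvdn_trans LN.
have [kx [t Ex]] := generator_modP hA x L0 (generator_mod_dvd dvdLmax ga).
(* Whatever [y] is, the residues only constrain it to be [kx] modulo [L]. *)
have residues y : (exists t, y = b *~ kx + t *+ L) ->
    exists k' : nat -> int, forall j, (j < K)%N ->
    (exists t, update eA i x j = a *~ k' j + t *+ L) /\
    (exists t, update eB i y j = b *~ k' j + t *+ L).
  move=> Ey; exists (update k i kx) => j jK; rewrite /update.
  case: eqP => _; first by split=> //; exists t.
  have [[u ->] [v ->]] := hk j jK; have /dvdnP[q ->] := dvdL.
  by split; [exists (u *+ q) | exists (v *+ q)]; rewrite -mulrnA.
have [[c [bc ci Ec]]|free] := EM (exists c,
    [/\ bounded N c, c i <> 0 & x *~ c i + lin K eA (update c i 0) = 0]).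
  (* [x] solves [c i * x = - d] for a linear form [d] in the other variables; so
     must [y], provided that the value of [d] in [B] is divisible by [c i]. *)
  set n := c i in ci Ec; pose d := update c i 0; rewrite -/d in Ec.
  have [u Eu] : exists t, lin K eA d = a *~ (\sum_(j < K) k j * d j) + t *+ (L * N`!).
    by apply: lin_residue => j /hk[].
  have [v Ev] : exists t, lin K eB d = b *~ (\sum_(j < K) k j * d j) + t *+ (L * N`!).
    by apply: lin_residue => j /hk[].
  set kd := \sum_(j < K) _ in Eu Ev.
  have [sg [absn nabs]] : exists sg : int, `|n|%:Z = n * sg /\ n = `|n|%:Z * sg.
    by exists (sgz n); rewrite ![_ * sgz n]mulrC -abszEsg -intEsg.
  have n0 : (0 < `|n|)%N by rewrite absz_gt0; apply/eqP.
  have /dvdnP[q Eq] : (`|n| %| N`!)%N by rewrite dvdn_fact // n0 bc.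
  have Lq : (L * N`!)%:Z = L%:Z * `|n|%:Z * q%:Z by rewrite Eq; lia.
  have mL : (L * `|n| %| L * N`!)%N by rewrite dvdn_pmul2l // Eq dvdn_mull.
  have [w Ew] : multiple (L * `|n|) (b *~ (kx * n + kd)).
    apply: (@generator_mod_order S A B Lmax a b) => //.
    - by rewrite muln_gt0 L0.
    - exact: dvdn_trans LN.
    exists (- (t *~ sg) - u *~ q%:Z).
    have -> : a *~ (kx * n + kd) = - (t *+ L *~ n) - u *+ (L * N`!).
      move: Ec; rewrite Ex Eu mulrzDl -mulrzA addrACA -mulrzDr => /eqP.
      by rewrite addr_eq0 opprD => /eqP.
    rewrite !pmulrn Lq mulrzBl mulNrz -!mulrzA.
    congr (- (t *~ _) - u *~ _); rewrite PoszM; last by ring.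
    by rewrite [in LHS]nabs; ring.
  pose y := b *~ kx - (w *~ sg + v *~ (q%:Z * sg)) *~ L%:Z.
  exists y; split; last first.
    by apply: residues; exists (- (w *~ sg + v *~ (q%:Z * sg))); rewrite pmulrn mulNrz.
  have Eyn : y *~ n = b *~ (kx * n) - (w *+ (L * `|n|) + v *+ (L * N`!)).
    rewrite !pmulrn Lq PoszM /y mulrzBl !mulrzDl -!mulrzA absn.
    by congr (_ - (_ *~ _ + _ *~ _)); ring.
  have Eyd : y *~ n + lin K eB d = 0.
    by rewrite Eyn Ev addrACA -mulrzDr Ew opprD subrK subrr.
  move=> c' bc'; rewrite (lin_update_eliminate c' hA iK ci Ec).
  rewrite (lin_update_eliminate c' hB iK ci Eyd).
  by apply: hc; apply: bounded_eliminate; [exact: bc' | exact: bc | exact: bounded_update..].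
have [s hs] := lin_finite K N eB.
have [z hz] := avoid_values
  [seq (b *~ (kx * n) + v, n * L%:Z) | v <- s, n <- small_ints N] hB.
exists (b *~ kx + z *+ L); split; last by apply: residues; exists z.
move=> c bc; rewrite !lin_update //; have bd := bounded_update i bc.
have [->|/eqP ci] := eqVneq (c i) 0.
  by rewrite !mulr0z !add0r; apply: hc; apply: bounded_le bd.
split=> [E|]; first by case: free; exists c.
rewrite mulrzDl -mulrzA pmulrn -mulrzA addrAC [L%:Z * _]mulrC => /hz[].
  apply/allpairsP; exists (lin K eB (update c i 0), c i).
  by split=> //; [exact: hs | exact/mem_small_ints/bc].
by apply/eqP; rewrite mulf_neq0 //; [exact/eqP | rewrite -lt0n].
Qed.

End BackAndForth.

(** * Elementary equivalence *)

Fixpoint coef (t : term) : nat -> int :=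
  match t with
  | tVar i => fun j => (j == i)%:R
  | tOne => fun=> 0
  | tInv t1 => fun j => - coef t1 j
  | tMul t1 t2 => fun j => coef t1 j + coef t2 j
  end.

Fixpoint term_size (t : term) : nat :=
  match t with
  | tVar _ | tOne => 1
  | tInv t1 => term_size t1
  | tMul t1 t2 => term_size t1 + term_size t2
  end.

Fixpoint term_bound (t : term) : nat :=
  match t with
  | tVar i => i.+1
  | tOne => 0
  | tInv t1 => term_bound t1
  | tMul t1 t2 => maxn (term_bound t1) (term_bound t2)
  end.

(** Bound variables count as well, since a quantifier updates the assignment at
    its variable. *)
Fixpoint var_bound (f : formula) : nat :=
  match f with
  | fEq t1 t2 => maxn (term_bound t1) (term_bound t2)
  | fNot f1 => var_bound f1
  | fAnd f1 f2 | fOr f1 f2 | fImp f1 f2 => maxn (var_bound f1) (var_bound f2)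
  | fAll i f1 | fEx i f1 => maxn i.+1 (var_bound f1)
  end.

Lemma bounded_coef t : bounded (term_size t) (coef t).
Proof.
elim: t => [i||t IHt|t IHt u IHu] j //=; first by case: eqP.
- by rewrite abszN IHt.
- have := leqD_dist (coef t j) 0 (- coef u j); rewrite subr0 sub0r !opprK => le.
  by apply: leq_trans le _; apply: leq_add.
Qed.

Lemma teval_lin (A : zmodType) K (e : nat -> A) t : (term_bound t <= K)%N ->
  teval (A := Algebra.to_multiplicative A) e t = lin K e (coef t).
Proof.
elim: t => [i iK||t IHt tK|t IHt u IHu] /=.
- rewrite /lin (bigD1 (Ordinal iK)) //= eqxx mulr1z big1 ?addr0 // => j.
  by rewrite -val_eqE /= => /negbTE->.
- by move=> _; rewrite /lin big1.
- by rewrite IHt // /lin -[LHS]sumrN; apply: eq_bigr => j _; rewrite mulrNz.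
by rewrite geq_max => /andP[tK uK]; rewrite IHt // IHu // linD.
Qed.

Section TruncatedTypes.
Variables (S : nat_pred) (K : nat).
Local Notation mul := Algebra.to_multiplicative.

(** The generators and their modulus stay the same throughout a game; only the
    precision [N], [L] drops with each move. *)
Definition related (N L : nat) (A B : zmodType) (eA : nat -> A) (eB : nat -> B) : Prop :=
  exists (a : A) (b : B) (Lmax : nat),
    [/\ generator_mod S Lmax a, generator_mod S Lmax b, (0 < Lmax)%N, (L %| Lmax)%N
      & similar K a b N L eA eB].

Lemma related_sym N L (A B : zmodType) (eA : nat -> A) (eB : nat -> B) :
  related N L eA eB -> related N L eB eA.
Proof.
by move=> [a [b [Lmax [ga gb L0 dL sim]]]]; exists b, a, Lmax; split=> //; exact: similar_sym.
Qed.

Lemma related_le N N' L L' (A B : zmodType) (eA : nat -> A) (eB : nat -> B) :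
  (N <= N')%N -> (L %| L')%N -> related N' L' eA eB -> related N L eA eB.
Proof.
move=> leN dvdL [a [b [Lmax [ga gb L0 dL sim]]]]; exists a, b, Lmax.
by split=> //; [exact: dvdn_trans dL | exact: similar_le sim].
Qed.

Lemma related_step N L (A B : zmodType) i (eA : nat -> A) (eB : nat -> B) x :
  Szmielew_class S A -> Szmielew_class S B -> (0 < N)%N -> (i < K)%N ->
  related (2 * N ^ 2) (L * N`!) eA eB ->
  exists y, related N L (update eA i x) (update eB i y).
Proof.
move=> hA hB N0 iK [a [b [Lmax [ga gb L0 dL sim]]]].
have [y simy] := similar_step x hA hB ga L0 N0 dL iK sim.
by exists y, a, b, Lmax; split=> //; apply: dvdn_trans dL; rewrite dvdn_mulr.
Qed.

Definition preserved (f : formula) (N L : nat) : Prop :=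
  forall (A B : zmodType) (eA : nat -> A) (eB : nat -> B),
  Szmielew_class S A -> Szmielew_class S B -> related N L eA eB ->
  holds (A := mul A) eA f -> holds (A := mul B) eB f.

(** By induction on [f]: the relation is symmetric, so negation and implication
    cause no loss of precision, and each quantifier costs one [related_step]. *)
Lemma preserved_exists f : (var_bound f <= K)%N ->
  exists N L, [/\ (0 < N)%N, (0 < L)%N & preserved f N L].
Proof.
have two f1 f2 f3 :
    (exists N L, [/\ (0 < N)%N, (0 < L)%N & preserved f1 N L]) ->
    (exists N L, [/\ (0 < N)%N, (0 < L)%N & preserved f2 N L]) ->
    (forall N L, preserved f1 N L -> preserved f2 N L -> preserved f3 N L) ->
    exists N L, [/\ (0 < N)%N, (0 < L)%N & preserved f3 N L].
  move=> [N1 [L1 [N10 L10 h1]]] [N2 [L2 [N20 L20 h2]]] h3.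
  exists (maxn N1 N2), (L1 * L2)%N; split; rewrite ?leq_max ?N10 ?muln_gt0 ?L10 //.
  apply: h3 => A B eA eB hA hB rel.
    by apply: h1 => //; apply: related_le rel; rewrite ?leq_maxl ?dvdn_mulr.
  by apply: h2 => //; apply: related_le rel; rewrite ?leq_maxr ?dvdn_mull.
elim: f => [t u|f IHf|f IHf g IHg|f IHf g IHg|f IHf g IHg|i f IHf|i f IHf] /=;
  rewrite ?geq_max.
- move=> /andP[tK uK]; exists (maxn 1 (term_size t + term_size u)), 1%N.
  split; [exact: leq_maxl | by [] |].
  move=> A B eA eB _ _ [_ [_ [_ [_ _ _ _ [hc _]]]]] /=.
  have E (C : zmodType) (e : nat -> C) : lin K e (fun j => coef t j - coef u j) =
      (teval (A := mul C) e t : C) - (teval (A := mul C) e u : C).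
    by rewrite linB !(@teval_lin _ K).
  have bc : bounded (maxn 1 (term_size t + term_size u)) (fun j => coef t j - coef u j).
    move=> j; apply: leq_trans (leq_maxr _ _).
    have := leqD_dist (coef t j) 0 (coef u j); rewrite subr0 sub0r abszN => le.
    by apply: leq_trans le _; apply: leq_add; apply: bounded_coef.
  move=> tu; apply/eqP; rewrite -subr_eq0 -E; apply/eqP/hc => //.
  by rewrite E tu subrr.
- move=> /IHf[N [L [N0 L0 h]]]; exists N, L; split=> // A B eA eB hA hB rel /= nf fB.
  by apply/nf/(h B A eB eA) => //; apply: related_sym.
- move=> /andP[/IHf hf /IHg hg]; apply: two hf hg _ => N L hf hg A B eA eB hA hB rel /=.
  by move=> [/hf fB /hg gB]; split; [exact: fB | exact: gB].
- move=> /andP[/IHf hf /IHg hg]; apply: two hf hg _ => N L hf hg A B eA eB hA hB rel /=.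
  by move=> [/hf fB|/hg gB]; [left; exact: fB | right; exact: gB].
- move=> /andP[/IHf hf /IHg hg]; apply: two hf hg _ => N L hf hg A B eA eB hA hB rel /=.
  move=> fg fB; apply: (hg A B eA eB) => //; apply/fg/(hf B A eB eA) => //.
  exact: related_sym.
- move=> /andP[iK /IHf[N [L [N0 L0 h]]]]; exists (2 * N ^ 2)%N, (L * N`!)%N.
  split; rewrite ?muln_gt0 ?expn_gt0 ?N0 ?L0 ?fact_gt0 // => A B eA eB hA hB rel /= fA y.
  have [x relx] := related_step y hB hA N0 iK (related_sym rel).
  by apply: (h _ _ _ _ hA hB (related_sym relx)); apply: fA.
move=> /andP[iK /IHf[N [L [N0 L0 h]]]]; exists (2 * N ^ 2)%N, (L * N`!)%N.
split; rewrite ?muln_gt0 ?expn_gt0 ?N0 ?L0 ?fact_gt0 // => A B eA eB hA hB rel /= [x fA].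
have [y rely] := related_step x hA hB N0 iK rel.
by exists y; apply: (h _ _ _ _ hA hB rely).
Qed.

End TruncatedTypes.

Lemma eq_teval (A : baseGroupType) (e e' : nat -> A) t :
  (forall j, j \in term_vars t -> e j = e' j) -> teval e t = teval e' t.
Proof.
elim: t => //= [i|t IHt|t IHt u IHu] ee'; first by rewrite ee' ?inE.
  by rewrite IHt.
by rewrite IHt ?IHu // => j jt; rewrite ee' // mem_cat jt ?orbT.
Qed.

Lemma holds_free_vars (A : baseGroupType) f (e e' : nat -> A) :
  (forall j, j \in free_vars f -> e j = e' j) -> holds e f -> holds e' f.
Proof.
elim: f e e' => [t u|f IHf|f IHf g IHg|f IHf g IHg|f IHf g IHg|i f IHf|i f IHf] /= e e' ee'.
- by rewrite !(@eq_teval _ e e') // => j jt; rewrite ee' // mem_cat jt ?orbT.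
- by move=> nf fe'; apply/nf/(IHf e') => // j jf; rewrite ee'.
- move=> [fe ge]; split; [apply: IHf fe | apply: IHg ge] => j jt;
    by rewrite ee' // mem_cat jt ?orbT.
- move=> [fe|ge]; [left; apply: IHf fe | right; apply: IHg ge] => j jt;
    by rewrite ee' // mem_cat jt ?orbT.
- move=> fg fe'; apply: (IHg e) => [j jg|]; first by rewrite ee' // mem_cat jg orbT.
  by apply/fg/(IHf e') => // j jf; rewrite ee' // mem_cat jf.
- move=> fA x; apply: IHf (fA x) => j jf; rewrite /update.
  by case: eqP => // /eqP ji; rewrite ee' // mem_filter ji.
move=> [x fx]; exists x; apply: IHf fx => j jf; rewrite /update.
by case: eqP => // /eqP ji; rewrite ee' // mem_filter ji.
Qed.

(** The zero assignments are related to any precision, and a sentence does not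
    see the assignment. *)
Theorem Szmielew_elementarily_equivalent S (A B : zmodType) :
  Szmielew_class S A -> Szmielew_class S B ->
  elementarily_equivalent (Algebra.to_multiplicative A) (Algebra.to_multiplicative B).
Proof.
wlog suff half : A B / Szmielew_class S A -> Szmielew_class S B -> forall f, sentence f ->
    true_in (Algebra.to_multiplicative A) f -> true_in (Algebra.to_multiplicative B) f.
  by move=> hA hB f sf; split; apply: half.
move=> hA hB f /nilP sf fA e; pose K := var_bound f.
have [N [L [N0 L0 pf]]] := @preserved_exists S K f (leqnn _).
have [a ga] := generator_mod_exists hA L0; have [b gb] := generator_mod_exists hB L0.
apply: (@holds_free_vars (Algebra.to_multiplicative B) f (fun=> 1%g)); first by rewrite sf.
apply: (pf A B (fun=> 0) (fun=> 0) hA hB _ (fA _)).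
exists a, b, L; split=> //; split=> [c _|].
  by rewrite /lin !big1 // => j _; rewrite mul0rz.
by exists (fun=> 0) => j _; split; exists 0; rewrite mul0rn mulr0z addr0.
Qed.

Lemma elementarily_equivalent_iso (A B C : baseGroupType) (h : A -> B) (g : B -> A) :
  cancel h g -> cancel g h ->
  h 1%g = 1%g -> {morph h : x / x^-1%g} -> {morph h : x y / (x * y)%g} ->
  elementarily_equivalent B C -> elementarily_equivalent A C.
Proof.
move=> hK gK h1 hV hM BC f sf; rewrite -(BC f sf).
have hI := can_inj hK.
have tevalE e t : teval (h \o e) t = h (teval e t).
  by elim: t => //= [t ->|t -> u ->]; rewrite ?hV ?hM.
have updE e i x : h \o update e i x = update (h \o e) i (h x).
  by apply/funext => j; rewrite /update /=; case: eqP.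
have holdsE e k : holds (h \o e) k <-> holds e k.
  elim: k e => [t u|k IHk|k IHk l IHl|k IHk l IHl|k IHk l IHl|i k IHk|i k IHk] e /=.
  - by rewrite !tevalE; split=> [/hI|->].
  - by rewrite IHk.
  - by rewrite IHk IHl.
  - by rewrite IHk IHl.
  - by rewrite IHk IHl.
  - split=> H x; first by rewrite -IHk updE; apply: H.
    by rewrite -[x]gK -updE IHk; apply: H.
  split=> -[x H]; first by exists (g x); rewrite -IHk updE gK.
  by exists (h x); rewrite -updE IHk.
split=> tf e; last by rewrite -holdsE; apply: tf.
have -> : e = h \o (g \o e) by apply/funext => j; rewrite /= gK.
by rewrite holdsE; apply: tf.
Qed.

(** * The additive group of Z[1/S] *)

(** The fractions need not be in lowest terms, which makes the closure under the
    ring operations immediate. *)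
Definition localization (p : nat) of prime p : {pred rat} := fun x =>
  `[< exists n d : int, ~~ (p %| d)%Z /\ x = n%:~R / d%:~R >].

Section LocalizationAtPrime.
Variables (p : nat) (pr_p : prime p).

Lemma ndvdz_neq0 (d : int) : ~~ (p %| d)%Z -> d%:~R != 0 :> rat.
Proof. by move=> pd; rewrite intr_eq0; apply: contraNneq pd => ->; rewrite dvdz0. Qed.

Lemma ndvdzM (d e : int) : ~~ (p %| d)%Z -> ~~ (p %| e)%Z -> ~~ (p %| d * e)%Z.
Proof. by rewrite !dvdzE abszM Euclid_dvdM // negb_or => -> ->. Qed.

Lemma localization_closed : subring_closed (localization pr_p).
Proof.
have p1 : ~~ (p %| 1)%Z by rewrite dvdzE dvdn1 neq_ltn prime_gt1 ?orbT.
split=> [|x y /asboolP[n [d [pd ->]]] /asboolP[m [e [pe ->]]]|x y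
  /asboolP[n [d [pd ->]]] /asboolP[m [e [pe ->]]]]; apply/asboolP.
- by exists 1, 1; rewrite divr1.
- exists (n * e - m * d), (d * e); split; first exact: ndvdzM.
  rewrite rmorphB !rmorphM /= -[in LHS]mulNr addf_div ?ndvdz_neq0 //.
  by rewrite mulNr.
exists (n * m), (d * e); split; first exact: ndvdzM.
by rewrite !rmorphM /= mulf_div.
Qed.

HB.instance Definition _ :=
  GRing.isSubringClosed.Build rat (localization pr_p) localization_closed.

(** It suffices to look at the generators: the 1/q for q in S lie in the
    localization at [p] because q is a prime other than [p]. *)
Lemma Zinv_localization (S : nat_pred) (x : Zinv S) :
  (forall q, q \in S -> prime q) -> p \notin S -> val x \in localization pr_p.
Proof.
move=> prS pS; have /asboolP := valP x; apply=> [z|q qS]; apply/asboolP.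
  by exists z, 1; rewrite divr1 dvdzE dvdn1 neq_ltn prime_gt1 ?orbT.
exists 1, q%:Z; rewrite div1r; split=> //.
by rewrite dvdzE dvdn_prime2 //=; [apply: contra pS => /eqP-> | exact: prS].
Qed.

End LocalizationAtPrime.

(** Since [b] inverts [l] modulo [p], the integer [k - l * (k * b)] is
    divisible by [p]. *)
Lemma residue_cancel (R : comNzRingType) (t u : R) (k l a b : int) p :
  a * p%:Z + b * l = 1 ->
  k%:~R + t *+ p + (l%:~R + u *+ p) *~ (- (k * b)) =
  ((k * a)%:~R + t - u *~ (k * b)) *+ p.
Proof.
move=> ab; have Ek : k%:~R = (k * (a * p%:Z + b * l))%:~R :> R by rewrite ab mulr1.
rewrite {1}Ek -[u *~ _]mulrzr -[_ *~ - _]mulrzr.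
rewrite -[t *+ p]mulr_natr -[u *+ p]mulr_natr -[(_ + _ - _) *+ p]mulr_natr.
by rewrite !(intrD, intrM, rmorphN) /= -pmulrn; ring.
Qed.

Lemma Zinv_Szmielew_class (S : nat_pred) : (forall p, p \in S -> prime p) ->
  Szmielew_class S (Zinv S).
Proof.
move=> prS; have divS p (x : Zinv S) : prime p -> p \in S -> multiple p x.
  move=> pr_p pS; have pinv : p%:R^-1 \in Zinv_pred S.
    by apply/asboolP => A _; apply.
  pose y : Zinv S := exist (fun q : rat => q \in Zinv_pred S) _ pinv.
  exists (x * y); apply: val_inj.
  by rewrite rmorphMn rmorphM /= -mulr_natr -mulrA mulVf ?mulr1 // pnatr_eq0 -lt0n prime_gt0.
(* 1 generates the quotient by [p]: if [x = n / d] and [u * d + v * p = 1]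
   then [x = u * n + p * (v * x)]. *)
have residue p (x : Zinv S) : prime p -> p \notin S -> exists k t, x = k%:~R + t *+ p.
  move=> pr_p pS; have /asboolP[n [d [pd Ex]]] := Zinv_localization pr_p x prS pS.
  have /coprimezP[[u v] /= uv] : coprimez d p.
    by rewrite coprimez_sym coprimezE prime_coprime // -dvdzE.
  exists (u * n), (x *~ v); apply: val_inj.
  have xd : val x * d%:~R = n%:~R by rewrite Ex divfK // (ndvdz_neq0 pd).
  have Ex1 : val x = val x * (u * d + v * p%:Z)%:~R by rewrite uv mulr1.
  rewrite rmorphD rmorph_int rmorphMn rmorphMz /= {1}Ex1 intrD !intrM -xd.
  by rewrite -[val x *~ v]mulrzr -mulr_natr -!pmulrn; ring.
split=> [x n n0 xn||//|p pr_p pS|p x y pr_p].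
- have /eqP := congr1 val xn.
  by rewrite rmorphMn rmorph0 mulrn_eq0 eqn0Ngt n0 => /eqP x0; apply: val_inj.
- by exists 1; apply/eqP/oner_neq0.
- exists 1 => -[t /(congr1 val)]; rewrite rmorphMn rmorph1 /=.
  have /asboolP[n [d [pd ->]]] := Zinv_localization pr_p t prS pS.
  have d0 := ndvdz_neq0 pd; move/(congr1 ( *%R^~ d%:~R)).
  rewrite mul1r -mulr_natr mulrAC divfK // pmulrn -intrM => /eqP; rewrite eqr_int => /eqP Ed.
  by move: pd; rewrite Ed dvdz_mull.
have [pS|pS] := boolP (p \in S); first by left; apply: divS.
have [k [t ->]] := residue p x pr_p pS; have [l [u ->]] := residue p y pr_p pS.
case pl: (p %| l)%Z.
  left; have /dvdzP[q ->] := pl; exists (q%:~R + u).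
  by rewrite mulrnDl rmorphM /= -mulrzr mulr_natr.
right; have /coprimezP[[a b] /= ab] : coprimez p l.
  by rewrite coprimezE prime_coprime // -dvdzE pl.
exists (- (k * b)), ((k * a)%:~R + t - u *~ (k * b)); exact: residue_cancel.
Qed.

(** * Maximal abelian subgroups *)

(** The proof of commutativity is a parameter of the type so that the additive
    structure can be inferred from the type alone. *)
Definition additive (H : groupType) of (forall x y : H, commute x y) : Type := H.

Section Additive.
Variables (H : groupType) (cH : forall x y : H, commute x y).
HB.instance Definition _ := Choice.on (additive cH).
HB.instance Definition _ := GRing.isZmodule.Build (additive cH)
  (@mulgA H) cH (@mul1g H) (@mulVg H).

Lemma additive_mulrn (x : additive cH) n : x *+ n = ((x : H) ^+ n)%g.
Proof. by elim: n => //= n IHn; rewrite mulrS expgS IHn. Qed.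

Lemma elementarily_equivalent_additive (B : baseGroupType) :
  elementarily_equivalent (Algebra.to_multiplicative (additive cH)) B ->
  elementarily_equivalent H B.
Proof.
by apply: (@elementarily_equivalent_iso H (Algebra.to_multiplicative (additive cH)) B id id).
Qed.

End Additive.

Section Centralizer.
Variables (G : groupType) (y : G).
Local Open Scope group_scope.

Definition commuting : {pred G} := fun g => `[< commute y g >].

Lemma commuting_closed : group_closed commuting.
Proof.
split=> [|g h /asboolP yg /asboolP yh]; apply/asboolP; first exact: commute1.
by apply: commuteM => //; apply: commuteV.
Qed.

Definition centralizer : groupClosed G :=
  HB.pack commuting (isMul1Closed.Build G commuting commuting_closed.1)
    (isMulClosed.Build G commuting (group_closedM commuting_closed))
    (isInvClosed.Build G commuting (group_closedV commuting_closed)).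

End Centralizer.

Section MaximalAbelian.
Variables (G : groupType) (M : groupClosed G).
Hypotheses (hG : almost_locally_free G) (hM : maximal_abelian M).
Local Open Scope group_scope.

Lemma centralizer_abelian (y : G) : y <> 1 -> abelian_subgroup (centralizer y).
Proof. by move=> y1 g h /asboolP yg /asboolP yh; exact: (alf_commute_trans hG y1 yg yh). Qed.

(** The centralizer of [y] contains [M] and is abelian, because commuting is
    transitive on the nontrivial elements. *)
Lemma centralizer_sub y g : y \in M -> y <> 1 -> commute y g -> g \in M.
Proof.
move=> yM y1 yg; apply: (hM.2 (centralizer y)); first exact: centralizer_abelian.
  by move=> m mM; apply/asboolP/hM.1.
exact/asboolP.
Qed.

(** Otherwise the centralizer of any nontrivial element of the group would be a
    larger abelian subgroup. *)
Lemma maximal_abelian_nontrivial : exists2 y, y \in M & y <> 1.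
Proof.
apply: contrapT => none.
have M1 m : m \in M -> m = 1 by move=> mM; apply: contrapT => m1; apply: none; exists m.
have [g g1] := alf_nontrivial hG; apply/g1/(M1).
apply: (hM.2 (centralizer g)); first exact: centralizer_abelian.
  by move=> m /M1->; apply/asboolP/commute1.
exact/asboolP/commute_refl.
Qed.

Lemma subgroup_commute (x y : subgroup_type M) : commute x y.
Proof. by apply: val_inj; apply: hM.1; apply: valP. Qed.

Lemma val_expg (x : subgroup_type M) n : val (x ^+ n) = val x ^+ n.
Proof. by elim: n => // n IHn; rewrite !expgS -IHn. Qed.

Definition divisible_primes (M : groupClosed G) : nat_pred := [pred p | prime p &&
  `[< forall x : subgroup_type M, exists t, x = t ^+ p >]].

Lemma maximal_abelian_Szmielew_class :
  Szmielew_class (divisible_primes M) (additive subgroup_commute).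
Proof.
split.
- move=> x n n0; rewrite additive_mulrn => /(congr1 val); rewrite val_expg => xn.
  by apply: val_inj; apply: (alf_torsion_free hG n0 xn).
- have [y yM y1] := maximal_abelian_nontrivial.
  by exists (exist (fun x : G => x \in M) y yM) => /(congr1 val).
- move=> p x _ /andP[_ /asboolP/(_ x)[t Et]].
  by exists t; rewrite additive_mulrn.
- move=> p pr_p; rewrite inE pr_p => /asboolPn/existsNP[x nx]; exists x => -[t Et].
  by apply: nx; exists t; rewrite Et additive_mulrn.
move=> p x y pr_p; have [y1|y1] := EM (y = 0).
  by left; exists 0; rewrite y1 mul0rn.
have vy1 : val y <> 1 by move=> E; apply: y1; apply: val_inj.
have xy : val x * val y = val y * val x by apply: hM.1; apply: valP.
have [t [_ ty Et]] := alf_commute_root hG pr_p xy.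
have tM : t \in M by apply: (centralizer_sub (valP y) vy1); exact: esym.
pose t' : subgroup_type M := exist (fun x : G => x \in M) t tM.
have vt : val (t' ^+ p) = t ^+ p by rewrite val_expg.
case: Et => [Ey|[b Eb]]; [left | right].
  by exists t'; rewrite additive_mulrn; apply: val_inj; rewrite vt.
have vb : val ((y : subgroup_type M) ^+ b) = val y ^+ b by exact: val_expg.
case: Eb => Eb; [exists b%:Z | exists (- b%:Z)%R]; exists t'; rewrite additive_mulrn.
  by rewrite -pmulrn additive_mulrn; apply: val_inj; rewrite vt -Eb -vb.
by rewrite mulrNz -pmulrn additive_mulrn; apply: val_inj; rewrite vt -Eb -vb.
Qed.

End MaximalAbelian.

Theorem theorem8 (G : groupType) (M : groupClosed G)
  (hG : almost_locally_free G) (hM : maximal_abelian M) :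
  exists S : nat_pred,
    (forall p : nat, p \in S -> prime p) /\
    elementarily_equivalent (subgroup_type M) (Zinv_group S).
Proof.
have prS p : p \in divisible_primes M -> prime p by case/andP.
exists (divisible_primes M); split=> //.
apply: (@elementarily_equivalent_additive _ (subgroup_commute hM)).
apply: (@Szmielew_elementarily_equivalent (divisible_primes M)); last exact: Zinv_Szmielew_class.
exact: maximal_abelian_Szmielew_class.
Qed.
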